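(* Let $R$ be a finite symmetric Frobenius $\mathbb{Z}/m$-algebra with the $2$-sum property. Let $\Gamma(R,S)$ be a gcd-graph over $R$, with $0\notin S$. Then $\Gamma(R,S)$ has no perfect state transfer (PST).
   Context: Rings are finite, unital, with $0\neq 1$, not necessarily commutative. A finite $\mathbb{Z}/m$-algebra $R$ is a symmetric Frobenius algebra if it is equipped with a $\mathbb{Z}/m$-linear functional $\psi\colon R\to\mathbb{Z}/m$ such that $\psi(ab)=\psi(ba)$ for all $a,b\in R$ and $\ker\psi$ contains no nonzero left ideal of $R$. $R$ has the $2$-sum property if every element of $R$ is a sum of exactly two units. The Cayley graph $\Gamma(R,S)$, $S\subset R$, has vertex set $R$ with $a,b$ adjacent if $a-b\in S$; it is a gcd-graph if $R^\times SR^\times=S$. For an undirected simple graph $G$ with adjacency matrix $A_G$, put $F(t)=\exp(\mathrm{i}A_Gt)$; PST occurs in $G$ if there exist distinct vertices $a,b$ and a real number $t>0$ with $|F(t)_{ab}|=1$. *)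

(* Defs.v *)
From HB Require Import structures.
From mathcomp Require Import all_boot all_order all_algebra complex.
From mathcomp Require Import all_classical all_reals all_analysis.

Set Implicit Arguments.
Unset Strict Implicit.
Unset Printing Implicit Defensive.

Import Order.TTheory GRing.Theory Num.Theory.
Import numFieldNormedType.Exports.

Local Open Scope ring_scope.
Local Open Scope complex_scope.

(** * Finite rings and symmetric Frobenius algebras *)

Definition left_ideal (R : finNzRingType) (I : {set R}) : Prop :=
  GRing.zmod_closed I /\ (forall a x : R, x \in I -> a * x \in I).

(* [{scalar R}] is the type of ['Z_m]-linear functionals [R -> 'Z_m].
   ['Z_m] is Z/m only when [1 < m]; the other values of [m] are excluded
   where this is used. *)
Definition symmetric_frobenius (m : nat) (R : finUnitAlgType 'Z_m)
    (psi : {scalar R}) : Prop :=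
  (forall a b : R, psi (a * b) = psi (b * a)) /\
  (forall I : {set R}, left_ideal I -> (forall x, x \in I -> psi x = 0) ->
     I = [set 0]%SET).

Definition two_sum_property (R : finUnitRingType) : Prop :=
  forall x : R, exists u v : R,
    [/\ u \is a GRing.unit, v \is a GRing.unit & x = u + v].

(** * Cayley graphs and gcd-graphs *)

Definition ring_units (R : finUnitRingType) : {set R} :=
  [set u : R | u \is a GRing.unit]%SET.

Definition setmul (R : finNzRingType) (A B : {set R}) : {set R} :=
  [set x * y | x in A, y in B]%SET.

Definition cayley (R : finNzRingType) (S : {set R}) : rel R :=
  fun a b => a - b \in S.

(* The condition on the generating set [S] for [cayley S] to be a gcd-graph. *)
Definition is_gcd_graph (R : finUnitRingType) (S : {set R}) : Prop :=
  setmul (setmul (ring_units R) S) (ring_units R) = S.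

(* A gcd-graph with [0 \notin S] is an undirected simple graph. *)
Lemma cayley_irreflexive (R : finNzRingType) (S : {set R}) :
  0 \notin S -> irreflexive (cayley S).
Proof. by move=> S0 a; rewrite /cayley subrr; apply/negbTE. Qed.

Lemma cayley_symmetric (R : finUnitRingType) (S : {set R}) :
  is_gcd_graph S -> symmetric (cayley S).
Proof.
move=> gS.
suff oppS (x : R) : x \in S -> - x \in S.
  by move=> a b; rewrite /cayley; apply/idP/idP => /oppS; rewrite opprB.
move=> Sx; rewrite -gS; apply/imset2P.
exists (- x) 1; rewrite ?mulr1 ?inE ?unitr1 //.
by apply/imset2P; exists (-1) x; rewrite ?mulN1r ?inE ?unitrN ?unitr1.
Qed.

(** * Continuous-time quantum walks *)

(* The limit is taken for the max norm on matrices.  Stated over a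
   [numFieldType] because [K[i]] has no canonical topology of its own: it gets
   the one induced by its modulus, through its [numFieldType] structure. *)
Definition expmx (C : numFieldType) (n : nat) (A : 'M[C]_n) : 'M[C]_n :=
  limn (series (fun k : nat => (k`!%:R : C)^-1 *: A ^+ k)).

(* Vertices index rows and columns through [enum_rank]. *)
Definition adjmx (K : realType) (T : finType) (e : rel T) : 'M[K[i]]_#|T| :=
  \matrix_(i, j) (e (enum_val i) (enum_val j))%:R.

Definition transition (K : realType) (T : finType) (e : rel T) (t : K) :
  'M[K[i]]_#|T| := expmx (('i * t%:C) *: adjmx K e).

(* The adjacency relation [e] is meant to be symmetric and irreflexive. *)
Definition has_PST (K : realType) (T : finType) (e : rel T) : Prop :=
  exists (a b : T) (t : K),
    [/\ a != b, 0 < t &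
        `|transition e t (enum_rank a) (enum_rank b)| = 1].

(* Main.v *)
Require Import Defs.
From HB Require Import structures.
From mathcomp Require Import all_boot all_order all_algebra complex.
From mathcomp Require Import all_classical all_reals all_analysis.

Import Order.TTheory GRing.Theory Num.Theory.
Import numFieldNormedType.Exports.

Local Open Scope ring_scope.

(** Perfect state transfer is so rigid that the target is determined by the
    source and the graph.  Indeed [F(t) = exp(iAt)] is unitary, so each of its
    rows has norm 1 and contains at most one entry of modulus 1; and [F(t)]
    commutes with every automorphism of the graph, as [A] does.  Hence an
    automorphism that fixes [a] also fixes the vertex [b] to which the state at
    [a] is transferred ([PST_target_fixed]).

    For a gcd-graph, [x |-> u (x - a) + a] is such an automorphism for every
    unit [u], because the generating set is stable under left multiplication by
    units.  So [d = b - a] satisfies [u d = d] for every unit [u].  When each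
    element [x] of the ring is a sum of two units, [x d = 2 d] for all [x], and
    comparing [x = 0] with [x = 1] gives [d = 0], that is [a = b].

    The analytic part is the unitarity of [F(t)] as the limit of a series of
    matrices ([cvg_exp_adjmx]).  The spectral theorem writes
    [A = P^-1 diag(l) P] with [P] unitary and [l] real; the exponential series
    of [i t A] then converges because that of each [i t l_k] does, its real and
    imaginary parts being the series of the cosine and of the sine. *)

Lemma mx_cvgP (T : topologicalType) (m n : nat) (u : nat -> 'M[T]_(m, n))
    (L : 'M[T]_(m, n)) :
  (u @ \oo --> L)%classic <->
  forall i j, ((fun N => u N i j) @ \oo --> L i j)%classic.
Proof.
split=> [uL i j B LB | uL B [P LP PB]].
  apply: (uL [set M : 'M[T]_(m, n) | B (M i j)])%classic.
  exists (fun i' j' => [set x | i' = i /\ j' = j -> B x])%classic.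
    move=> i' j'; have [[-> ->]|ne] := pselect (i' = i /\ j' = j).
      by apply: filterS LB => x Bx.
    by apply: filterS filterT => x _ /ne.
  by move=> M /= H; apply: H.
suff: (\forall N \near \oo, forall i j, P i j (u N i j))%classic.
  by apply: filterS => N H; apply: PB.
apply: filter_forall => i; apply: filter_forall => j; exact: uL (LP i j).
Qed.

(** Conjugation by [P] commutes with powers and with linear combinations, so each
    entry of a partial sum is a fixed linear combination of the partial sums
    of the scalar exponential series at the diagonal entries. *)
Lemma cvg_expmx_diagonalizable (C : numFieldType) (n : nat) (P : 'M[C]_n)
    (d e : 'rV[C]_n) :
  P \in unitmx ->
  (forall k, (series (fun j : nat => (j`!%:R)^-1 * d ord0 k ^+ j) @ \oo -->
              e ord0 k)%classic) ->
  (series (fun j : nat => (j`!%:R : C)^-1 *: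
     (invmx P *m diag_mx d *m P) ^+ j) @ \oo -->
   invmx P *m diag_mx e *m P)%classic.
Proof.
move=> Pu de.
have powE j : (invmx P *m diag_mx d *m P) ^+ j =
              invmx P *m diag_mx (\row_k d ord0 k ^+ j) *m P.
  elim: j => [|j IHj].
    rewrite expr0 (_ : (\row_k _) = const_mx 1) ?diag_const_mx ?mulmx1 ?mulVmx //.
    by apply/rowP => k; rewrite !mxE expr0.
  rewrite exprS IHj -[LHS]/(_ *m _) -!mulmxA (mulmxA P (invmx P)) mulmxV // mul1mx.
  congr (_ *m _); rewrite !mulmxA mulmx_diag; congr (diag_mx _ *m _).
  by apply/rowP => k; rewrite !mxE exprS.
apply/mx_cvgP => a b.
have entry (f : 'rV[C]_n) : (invmx P *m diag_mx f *m P) a b =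
    \sum_k invmx P a k * P k b * f ord0 k.
  by rewrite mxE; apply: eq_bigr => k _; rewrite mul_mx_diag mxE mulrAC.
rewrite entry [X in (X @ _)%classic](_ : _ = fun N => \sum_k invmx P a k * P k b *
    series (fun j : nat => (j`!%:R)^-1 * d ord0 k ^+ j) N); last first.
  apply/funext => N; rewrite /series /= summxE.
  under [LHS]eq_bigr => j _ do rewrite mxE powE entry big_distrr.
  rewrite exchange_big; apply: eq_bigr => k _ /=; rewrite [RHS]big_distrr.
  by apply: eq_bigr => j _; rewrite mxE mulrCA.
apply: cvg_big => [|k _]; first exact: add_continuous.
by apply: cvgMr; exact: de.
Qed.

(** Euler's formula.  The functions [cos] and [sin] are sums of power series
    indexed by all exponents, with zeros at those of the wrong parity; their
    [j]-th terms are thus the real and imaginary parts of [(ix)^j / j!]. *)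
Lemma cvg_expi (K : realType) (x : K) :
  (series (fun j : nat => (j`!%:R)^-1 * (('i * x%:C)%C : (K[i] : numFieldType)) ^+ j)
    @ \oo --> ((cos x +i* sin x)%C : (K[i] : numFieldType)))%classic.
Proof.
(* A positive bound in [K[i]] is real, so that convergence of real sequences
   transfers along the embedding of [K]. *)
have real_cvg (u : nat -> K) (l : K) : (u @ \oo --> l)%classic ->
  ((fun N => (u N)%:C%C : (K[i] : numFieldType)) @ \oo -->
     ((l%:C)%C : (K[i] : numFieldType)))%classic.
  move=> /cvgrPdist_lt ul; apply/cvgrPdist_lt => e e0.
  have [eIm eRe] : complex.Im e = 0 /\ 0 < complex.Re e.
    by move: e0; rewrite ltcE /= => /andP[/eqP -> ->].
  have eE : e = ((complex.Re e)%:C)%C by case: e eIm {e0 eRe} => a b /= ->.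
  apply: filterS (ul _ eRe) => N; rewrite {2}eE -rmorphB /= normc_def /=.
  by rewrite expr0n addr0 sqrtr_sqr ltcR.
have -> : (cos x +i* sin x)%C = ((cos x)%:C + 'i * (sin x)%:C)%C :> K[i].
  by apply/eqP; rewrite eq_complex /= !mul0r !mul1r !(addr0, add0r, subr0, sub0r) ?eqxx.
have powi j : ((j`!%:R)^-1 * ('i * x%:C) ^+ j)%C =
    ((cos_coeff x j)%:C + 'i * (sin_coeff x j)%:C)%C :> K[i].
  rewrite exprMn -[in 'i%C ^+ j](odd_double_half j) exprD -mul2n exprM sqr_i.
  have -> : ((-1) ^+ j./2 : K[i]) = (((-1) ^+ j./2)%:C)%C by rewrite rmorphXn rmorphN1.
  have -> : ((x%:C)%C ^+ j) = ((x ^+ j)%:C)%C by rewrite rmorphXn.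
  have -> : (j`!%:R)^-1 = ((j`!%:R)^-1%:C)%C :> K[i] by rewrite fmorphV rmorph_nat.
  rewrite /cos_coeff /sin_coeff /=; case: (boolP (odd j)) => jodd /=.
    have -> : j.-1./2 = j./2 by rewrite -[in LHS](odd_double_half j) jodd doubleK.
    by rewrite !mul0r expr1 add0r !mul1r !rmorphM /= -mulrA mulrC -!mulrA.
  by rewrite !mul0r mulr0 addr0 expr0 !mul1r !rmorphM /= mulrC.
rewrite (_ : series _ = fun N => ((series (cos_coeff x) N)%:C +
   'i * (series (sin_coeff x) N)%:C)%C); last first.
  apply/funext => N; rewrite /series /= !rmorph_sum big_distrr -big_split /=.
  by apply: eq_bigr => j _; exact: powi.
apply: cvgD; first by apply: real_cvg; rewrite unlock; exact: is_cvg_series_cos_coeff.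
by apply: cvgMr; apply: real_cvg; rewrite unlock; exact: is_cvg_series_sin_coeff.
Qed.

Lemma normc_expi (K : realType) (x : K) : `|(cos x +i* sin x)%C : K[i]| = 1.
Proof. by rewrite normc_def /= cos2Dsin2 sqrtr1. Qed.

Lemma unitarymx_diagonalizable (C : numClosedFieldType) (n : nat) (P : 'M[C]_n)
    (e : 'rV[C]_n) :
  P \is unitarymx -> (forall k, `|e ord0 k| = 1) ->
  invmx P *m diag_mx e *m P \is unitarymx.
Proof.
move=> Pu e1; rewrite !mul_unitarymx // ?invmx_unitary ?trmxC_unitary //.
apply/unitarymxP; rewrite tr_diag_mx map_diag_mx mulmx_diag.
rewrite -diag_const_mx; congr diag_mx; apply/rowP => k.
by rewrite !mxE -normCK e1 expr1n.
Qed.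

Lemma unitarymx_row_norm (C : numClosedFieldType) (n : nat) (U : 'M[C]_n)
    (i : 'I_n) :
  U \is unitarymx -> \sum_j `|U i j| ^+ 2 = 1.
Proof.
move=> /unitarymxP/matrixP/(_ i i); rewrite !mxE eqxx => Uii.
rewrite -[RHS]/(true%:R) -Uii.
by apply: eq_bigr => j _; rewrite !mxE normCK.
Qed.

(** A row of a unitary matrix has norm 1, which leaves no room for two entries of
    modulus 1. *)
Lemma unitarymx_entry_inj (C : numClosedFieldType) (n : nat) (U : 'M[C]_n)
    (i j k : 'I_n) :
  U \is unitarymx -> `|U i j| = 1 -> `|U i k| = 1 -> j = k.
Proof.
move=> Uu Uj Uk; apply/eqP/negPn/negP => jk.
have := unitarymx_row_norm C n U i Uu.
rewrite (bigD1 j) //= (bigD1 k) /= 1?eq_sym // Uj Uk expr1n => /eqP.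
rewrite -subr_eq0 addrAC subrr add0r gt_eqF //.
by rewrite ltr_pwDl // sumr_ge0 // => l _; rewrite exprn_ge0.
Qed.

(** The matrix is real symmetric, so its eigenvalues are real and their
    exponentials [e^(i t d_k)] lie on the unit circle.  Convergence is part of the
    conclusion because [expmx] is the value of a limit, which is meaningful only
    when the series converges. *)
Lemma cvg_exp_adjmx (K : realType) (T : finType) (e : rel T) (t : K) :
  symmetric e ->
  exists2 U : 'M[(K[i] : numClosedFieldType)]_#|T|, U \is unitarymx &
  (series (fun k : nat => (k`!%:R : (K[i] : numFieldType))^-1 *:
     ((('i * t%:C)%C : (K[i] : numFieldType)) *: adjmx K e) ^+ k) @ \oo --> U)%classic.
Proof.
move=> esym; pose C : numClosedFieldType := K[i]; set A := adjmx K e.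
have Aherm : (A : 'M[C]_#|T|) \is hermsymmx.
  apply/is_hermitianmxP; rewrite expr0 scale1r; apply/matrixP => i j.
  by rewrite !mxE esym rmorph_nat.
set P := spectralmx (A : 'M[C]_#|T|); set d := spectral_diag (A : 'M[C]_#|T|).
have AE : A = invmx P *m diag_mx d *m P.
  exact/orthomx_spectralP/hermitian_normalmx.
have dreal k : d ord0 k = (complex.Re (d ord0 k))%:C%C.
  have /mxOverP/(_ ord0 k) := hermitian_spectral_diag_real Aherm.
  by move=> /RRe_real.
have Pu := spectral_unitarymx (A : 'M[C]_#|T|).
pose x k := t * complex.Re (d ord0 k).
pose f : 'rV[C]_#|T| := \row_k (cos (x k) +i* sin (x k))%C.
exists (invmx P *m diag_mx f *m P).
  by apply: unitarymx_diagonalizable => // k; rewrite mxE normc_expi.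
rewrite AE scalemxAl scalemxAr -linearZ /=.
apply: cvg_expmx_diagonalizable; first exact: spectral_unit.
move=> k; rewrite !mxE dreal -mulrA -rmorphM; exact: cvg_expi.
Qed.

Lemma transition_unitary (K : realType) (T : finType) (e : rel T) (t : K) :
  symmetric e -> (transition e t : 'M[(K[i] : numClosedFieldType)]_#|T|) \is unitarymx.
Proof.
move=> esym; have [U Uu AU] := cvg_exp_adjmx K T e t esym.
by rewrite /transition /expmx (cvg_lim (@norm_hausdorff _ _) AU).
Qed.

(** By induction the powers of the adjacency matrix are invariant under the
    automorphism, hence so are the partial sums of the series; the limit
    inherits this by uniqueness of limits. *)
Lemma transition_automorphism (K : realType) (T : finType) (e : rel T) (t : K)
    (s : T -> T) (a b : T) :
  symmetric e -> injective s -> (forall x y, e (s x) (s y) = e x y) ->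
  transition e t (enum_rank (s a)) (enum_rank (s b)) =
  transition e t (enum_rank a) (enum_rank b).
Proof.
move=> esym sinj se; have [U Uu AU] := cvg_exp_adjmx K T e t esym.
rewrite /transition /expmx (cvg_lim (@norm_hausdorff _ _) AU).
move/mx_cvgP: AU => AU; set A := series _ in AU *.
have AE N : A N (enum_rank (s a)) (enum_rank (s b)) =
            A N (enum_rank a) (enum_rank b).
  rewrite /A /series /= !summxE; apply: eq_bigr => k _.
  rewrite !mxE; congr (_ * _); elim: k a b {A AU} => [|k IHk] a b.
    by rewrite !expr0 !mxE !(inj_eq enum_rank_inj) (inj_eq sinj).
  rewrite !exprS -!/(_ *m _) !mxE.
  (* Summing over vertices instead of their ranks allows a reindexing by [s]. *)
  rewrite !(reindex _ (onW_bij _ (enum_rank_bij T))) (reindex_inj sinj) /=.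
  by apply: eq_bigr => x _; rewrite IHk !mxE !enum_rankK se.
have Uab := AU (enum_rank (s a)) (enum_rank (s b)).
rewrite (funext AE) in Uab.
exact: (cvg_unique (@norm_hausdorff _ (K[i] : numFieldType)) Uab (AU _ _)).
Qed.

(** The transition entries from [a] to [b] and from [a = s a] to [s b] coincide, and
    a unitary row has at most one entry of modulus 1. *)
Lemma PST_target_fixed (K : realType) (T : finType) (e : rel T) (t : K)
    (s : T -> T) (a b : T) :
  symmetric e -> injective s -> (forall x y, e (s x) (s y) = e x y) ->
  s a = a -> `|transition e t (enum_rank a) (enum_rank b)| = 1 -> s b = b.
Proof.
move=> esym sinj se sa ab1; apply: enum_rank_inj.
apply: (unitarymx_entry_inj _ _ _ _ _ _ (transition_unitary K T e t esym) _ ab1).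
by rewrite -[X in enum_rank X]sa transition_automorphism.
Qed.

Lemma gcd_graph_mulu (R : finUnitRingType) (S : {set R}) (u x : R) :
  is_gcd_graph S -> u \is a GRing.unit -> x \in S -> u * x \in S.
Proof.
move=> hS uu xS; rewrite -hS; apply/imset2P; exists (u * x) 1.
- by apply/imset2P; exists u x; rewrite ?inE.
- by rewrite inE unitr1.
- by rewrite mulr1.
Qed.

(** Writing [x] as a sum of two units gives [x * d = d + d] for every [x]; the
    values [x = 0] and [x = 1] are then equal. *)
Lemma two_sum_unit_fixed (R : finUnitRingType) (d : R) :
  two_sum_property R -> (forall u : R, u \is a GRing.unit -> u * d = d) -> d = 0.
Proof.
move=> h2 ud.
have xd x : x * d = d + d by have [u [v [uu uv ->]]] := h2 x; rewrite mulrDl !ud.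
by rewrite -[LHS]mul1r xd -(xd 0) mul0r.
Qed.

Theorem corollary4p3 (K : realType) (m : nat) (hm : (1 < m)%N)
    (R : finUnitAlgType 'Z_m) (psi : {scalar R})
    (hpsi : symmetric_frobenius psi) (h2 : two_sum_property R)
    (S : {set R}) (hS : is_gcd_graph S) (hS0 : 0 \notin S) :
  ~ has_PST K (cayley S).
Proof.
case=> a [b [t [neq_ab _ ab1]]]; case/eqP: neq_ab; apply/esym/subr0_eq.
apply: (two_sum_unit_fixed R _ h2) => u uu.
(* The automorphism of multiplication by [u], recentred so as to fix [a]. *)
pose s x := u * (x - a) + a.
have sinj : injective s by move=> x y /addIr/(mulrI uu)/addIr.
have se x y : cayley S (s x) (s y) = cayley S x y.
  rewrite /cayley /s opprD addrACA subrr addr0 -mulrBr opprB addrA subrK.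
  apply/idP/idP => [|xyS]; last exact: gcd_graph_mulu.
  by move/(gcd_graph_mulu _ _ u^-1 _ hS); rewrite unitrV mulKr //; apply.
have sa : s a = a by rewrite /s subrr mulr0 add0r.
have := PST_target_fixed _ _ _ _ s a b (cayley_symmetric hS) sinj se sa ab1.
by move=> /(canRL (addrK a)).
Qed.
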